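(* Let $w$ be a word over the alphabet $\{a,b\}$. Suppose that $w$ contains three or more powers of one letter separated by powers of the other letter; that is, for some choice of letters $x,y$ with $\{x,y\}=\{a,b\}$ and some positive integers $i_1,j_1,i_2,j_2,i_3$, the word $x^{i_1}y^{j_1}x^{i_2}y^{j_2}x^{i_3}$ is a factor of $w$. Then $w$ contains a non-trivial abelian square.
   Context: A factor of a word $w=w[1\dots n]$ is a contiguous subword $w[i\dots j]$. For a word $u$ over $\{a,b\}$, $|u|_a$ and $|u|_b$ denote the numbers of $a$'s and $b$'s in $u$, and the Parikh vector of $u$ is $\mathcal{P}(u)=[|u|_a,|u|_b]$. An abelian square is a word $uv$ with $|u|=|v|\ge 1$ and $\mathcal{P}(u)=\mathcal{P}(v)$; a word $w$ contains it if it is a factor of $w$. An abelian square is trivial if it has the form $a^{2i}$ or $b^{2i}$ for some positive integer $i$, and non-trivial otherwise. *)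

(* Defs.v *)
From mathcomp Require Import all_boot.

Set Implicit Arguments.
Unset Strict Implicit.
Unset Printing Implicit Defensive.

(* The two-letter alphabet {a, b}, encoded by bool. *)
Definition letter : finType := bool.
Definition la : letter := false.
Definition lb : letter := true.

Definition word := seq letter.

Definition parikh (u : word) : nat * nat := (count_mem la u, count_mem lb u).

Definition abelian_square (s : word) : Prop :=
  exists u v : word,
    [/\ s = u ++ v, size u = size v, 1 <= size u & parikh u = parikh v].

Definition trivial_square (s : word) : Prop :=
  exists2 i : nat, 0 < i & s = nseq (2 * i) la \/ s = nseq (2 * i) lb.

Definition contains_nontrivial_abelian_square (w : word) : Prop :=
  exists s : word, [/\ infix s w, abelian_square s & ~ trivial_square s].

(* Main.v *)
Require Import Defs.
From mathcomp Require Import all_boot.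

(** Only the central block x^i, between y^{j1} and y^{j2}, and its surroundings
    matter.  If i = 2m, then
    y x^m . x^m y is an abelian square.  If i = 2m+1, one extra x has to be
    found outside the block: when j1 <= j2 it is the x just before y^{j1}, and
    x y^{j1} x^m . x^{m+1} y^{j1} is an abelian square; when j2 <= j1 it is,
    symmetrically, the x just after y^{j2}, giving
    y^{j2} x^{m+1} . x^m y^{j2} x.  Each of these squares contains both
    letters, hence is not trivial. *)

(** The two halves of an abelian square are rearrangements of each other, and
    a trivial square has only one letter: this reduces the theorem to
    exhibiting suitable adjacent factors. *)
Lemma perm_eq_factor_nontrivial_square (p u v s : word) (c d : letter) :
  c != d -> c \in u -> d \in u -> perm_eq u v ->
  contains_nontrivial_abelian_square (p ++ u ++ v ++ s).
Proof.
move=> cd cu du uv; exists (u ++ v); split.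
- by apply/infixP; exists p, s; rewrite -!catA.
- exists u, v; split=> //; [exact: perm_size | | ].
  + by case: u cu {du uv}.
  + by rewrite /parikh !(permP uv).
- have cuv : c \in u ++ v by rewrite mem_cat cu.
  have duv : d \in u ++ v by rewrite mem_cat du.
  case=> n _ [] uvE; move: cuv duv; rewrite uvE !mem_nseq;
    by case/andP=> _ /eqP cE /andP[_ /eqP dE]; rewrite cE dE eqxx in cd.
Qed.

Lemma contains_nontrivial_square_cat (p w s : word) :
  contains_nontrivial_abelian_square w ->
  contains_nontrivial_abelian_square (p ++ w ++ s).
Proof.
case=> q [qw sq ntq]; exists q; split=> //.
exact: infix_trans qw (infix_infix p w s).
Qed.

(** The outer powers of x are shortened to single letters, since the square
    uses at most one x outside the central block, and only when [i] is odd. *)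
Lemma alternating_blocks_nontrivial_square (x y : letter) (j i k : nat) :
  x != y -> 0 < j -> 0 < i -> 0 < k ->
  contains_nontrivial_abelian_square
    ([:: x] ++ nseq j y ++ nseq i x ++ nseq k y ++ [:: x]).
Proof.
move=> xy j0 i0 k0; have yx : y != x by rewrite eq_sym.
have [m iE] : exists m, i = odd i + (m + m).
  by exists i./2; rewrite addnn odd_double_half.
case: (odd i) iE => iE; rewrite /= in iE.
- case: (leqP j k) => [jk | /ltnW kj].
  + have -> : [:: x] ++ nseq j y ++ nseq i x ++ nseq k y ++ [:: x]
            = [::] ++ ([:: x] ++ nseq j y ++ nseq m x)
                   ++ (nseq m.+1 x ++ nseq j y) ++ (nseq (k - j) y ++ [:: x]).
      rewrite -{1}(subnKC jk) iE add1n -addnS !nseqD.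
      by rewrite -!catA.
    apply: (perm_eq_factor_nontrivial_square _ _ _ _ _ _ xy).
    * by rewrite mem_head.
    * by rewrite !mem_cat !mem_nseq j0 eqxx orbT.
    by rewrite perm_cons perm_catC.
  + have -> : [:: x] ++ nseq j y ++ nseq i x ++ nseq k y ++ [:: x]
            = ([:: x] ++ nseq (j - k) y) ++ (nseq k y ++ nseq m.+1 x)
                   ++ (nseq m x ++ nseq k y ++ [:: x]) ++ [::].
      rewrite -{1}(subnK kj) iE add1n -addSn !nseqD.
      by rewrite cats0 -!catA.
    apply: (perm_eq_factor_nontrivial_square _ _ _ _ _ _ xy).
    * by rewrite mem_cat mem_nseq /= mem_head orbT.
    * by rewrite mem_cat mem_nseq k0 eqxx.
    by rewrite perm_sym catA cats1 perm_rcons -[nseq m.+1 x]/(x :: nseq m x)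
               perm_sym perm_catC /= perm_cons.
- have m0 : 0 < m by case: m iE i0 => // ->.
  case: j j0 => // j _; case: k k0 => // k _.
  have -> : [:: x] ++ nseq j.+1 y ++ nseq i x ++ nseq k.+1 y ++ [:: x]
          = ([:: x] ++ nseq j y) ++ ([:: y] ++ nseq m x)
                 ++ (nseq m x ++ [:: y]) ++ (nseq k y ++ [:: x]).
    by rewrite iE add0n -(addn1 j) !nseqD -!catA.
  apply: (perm_eq_factor_nontrivial_square _ _ _ _ _ _ xy).
  + by rewrite mem_cat mem_nseq m0 eqxx orbT.
  + by rewrite mem_head.
  by rewrite perm_catC.
Qed.

Theorem theorem3 (w : word) :
  (exists x y : letter, exists i1 j1 i2 j2 i3 : nat,
     [/\ [set x; y] = [set la; lb],
         [/\ 0 < i1, 0 < j1, 0 < i2, 0 < j2 & 0 < i3] &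
         infix (nseq i1 x ++ nseq j1 y ++ nseq i2 x ++ nseq j2 y ++ nseq i3 x)
               w]) ->
  contains_nontrivial_abelian_square w.
Proof.
move=> [x [y [i1 [j1 [i2 [j2 [i3 [xyE [i1_gt0 j1_gt0 i2_gt0 j2_gt0 i3_gt0]]]]]]]]].
have xy : x != y.
  by have := cards2 x y; rewrite xyE cards2; case: (x != y).
case/infixP=> p [s ->]; apply: contains_nontrivial_square_cat.
rewrite -(prednK i1_gt0) -(addn1 i1.-1) -(prednK i3_gt0) -(add1n i3.-1) !nseqD.
have := alternating_blocks_nontrivial_square _ _ _ _ _ xy j1_gt0 i2_gt0 j2_gt0.
by move/(contains_nontrivial_square_cat (nseq i1.-1 x) _ (nseq i3.-1 x));
   rewrite -!catA.
Qed.
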